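(* There exists a group $G$, generated by elements of infinite order, for which there exist a positive integer $k$ and fixed torsion elements $x_1,\dots,x_k\in G$ such that \[ g^{x_1}g^{x_2}\cdots g^{x_k}=1\qquad\text{for every } g\in G. \]
   Context: Here $g^x=x^{-1}gx$, and a torsion element of a group is an element of finite order (the identity included). *)

(* Defs.v *)
From mathcomp Require Import all_boot.
From mathcomp Require Import fingroup.

Set Implicit Arguments.
Unset Strict Implicit.
Unset Printing Implicit Defensive.

Local Open Scope group_scope.

Definition torsion (G : groupType) (x : G) : Prop :=
  exists n : nat, (0 < n)%N /\ x ^+ n = 1.

Definition infinite_order (G : groupType) (x : G) : Prop := ~ torsion x.

(* [group_closed] of the library is about boolean predicates; subgroups of an
   infinite group need not be decidable, hence the Prop-valued version. *)
Record is_subgroup (G : groupType) (H : G -> Prop) : Prop := IsSubgroup {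
  subgroup1 : H 1;
  subgroupM : forall x y : G, H x -> H y -> H (x * y);
  subgroupV : forall x : G, H x -> H x^-1
}.

Definition generates (G : groupType) (S : G -> Prop) : Prop :=
  forall H : G -> Prop,
    is_subgroup H -> (forall s : G, S s -> H s) -> forall g : G, H g.

(* The generating set is nonempty: the empty set generates the trivial group,
   which contains no element of infinite order. *)
Definition generated_by_infinite_order_elements (G : groupType) : Prop :=
  exists S : G -> Prop,
    [/\ exists s : G, S s,
        forall s : G, S s -> infinite_order s
      & generates S].

(* Main.v *)
(** In the infinite dihedral group [D], the square of any element is a
    translation, and conjugation by a reflection [s] inverts translations; hence
    [g g g^s g^s = 1] for all [g]. The elements of infinite order of [D] only
    generate its translations, but in [D * D] the pairs (reflection, translation)
    have infinite order as well, and there they generate everything. The identity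
    passes to [D * D], with [(s, s)] in place of [s]. *)
Require Import Defs.
From HB Require Import structures.
From mathcomp Require Import all_boot.
From mathcomp Require Import fingroup.
From mathcomp Require Import ssralg ssrint ring.

Local Open Scope group_scope.

(* [(n, b)] stands for the isometry [z |-> n + (-1)^b z] of the integers. *)
Definition dihedral : Type := (int * bool)%type.

HB.instance Definition _ := Choice.copy dihedral (int * bool)%type.

(** Composition of isometries, with [h] applied first. *)
Definition dihedral_mul (g h : dihedral) : dihedral :=
  ((g.1 + (-1) ^+ g.2 * h.1)%R, g.2 (+) h.2).

Definition dihedral_inv (g : dihedral) : dihedral :=
  ((- ((-1) ^+ g.2 * g.1))%R, g.2).

Lemma dihedral_mulA : associative dihedral_mul.
Proof.
move=> [m a] [n b] [p c]; rewrite /dihedral_mul /= addbA.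
by congr pair; case: a; case: b; rewrite /=; ring.
Qed.

Lemma dihedral_mul1g : left_id (0%R, false) dihedral_mul.
Proof. by move=> [m a]; rewrite /dihedral_mul /=; congr pair; ring. Qed.

Lemma dihedral_mulg1 : right_id (0%R, false) dihedral_mul.
Proof.
by move=> [m a]; rewrite /dihedral_mul /= addbF; congr pair; ring.
Qed.

Lemma dihedral_mulVg : left_inverse (0%R, false) dihedral_inv dihedral_mul.
Proof.
by move=> [m a]; rewrite /dihedral_mul /= addbb; congr pair; case: a => /=; ring.
Qed.

Lemma dihedral_mulgV : right_inverse (0%R, false) dihedral_inv dihedral_mul.
Proof.
by move=> [m a]; rewrite /dihedral_mul /= addbb; congr pair; case: a => /=; ring.
Qed.

HB.instance Definition _ := isGroup.Build dihedral
  dihedral_mulA dihedral_mul1g dihedral_mulg1 dihedral_mulVg dihedral_mulgV.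

Definition translation : dihedral := (1%R, false).

Definition reflection : dihedral := (0%R, true).

Lemma infinite_order_translation : infinite_order translation.
Proof.
have translationX n : translation ^+ n = (Posz n, false) :> dihedral.
  elim: n => [|n IHn] //; rewrite expgS IHn.
  by rewrite [LHS]/(dihedral_mul _ _) /dihedral_mul /= GRing.mul1r -intS.
by move=> [[|n] [//]]; rewrite translationX => _ [].
Qed.

Lemma sqr_mul_conj_reflection (g : dihedral) :
  (g * g) * (g * g) ^ reflection = 1.
Proof.
have reflectionV : reflection^-1 = reflection by [].
rewrite conjgE reflectionV; case: g => m a.
rewrite [LHS]/(dihedral_mul _ _) /dihedral_mul /=.
(* If [a] is true, [g * g] is already trivial; otherwise it is the translation by [2m], which the
   conjugation turns into that by [-2m]. *)
by congr pair; case: a => /=; ring.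
Qed.

Lemma pairX (G H : groupType) (g : G * H) n : g ^+ n = (g.1 ^+ n, g.2 ^+ n).
Proof. by elim: n => [|n IHn] //; rewrite !expgS IHn. Qed.

Lemma infinite_order_fst (G H : groupType) (g : G * H) :
  infinite_order g.1 -> infinite_order g.
Proof.
by move=> inf_g [n [n_gt0]]; rewrite pairX => -[gn1 _]; apply: inf_g; exists n.
Qed.

Lemma infinite_order_snd (G H : groupType) (g : G * H) :
  infinite_order g.2 -> infinite_order g.
Proof.
by move=> inf_g [n [n_gt0]]; rewrite pairX => -[_ gn1]; apply: inf_g; exists n.
Qed.

(** A coordinate equal to [t] forces infinite order and leaves the other coordinate free. *)
Lemma generated_by_infinite_order_square (G : groupType) (t : G) :
  infinite_order t -> generated_by_infinite_order_elements (G * G)%type.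
Proof.
move=> inf_t; exists (@infinite_order (G * G)%type); split=> //.
  by exists (t, 1); apply: infinite_order_fst.
move=> H [_ HM HV] inf_H [a b].
(* Each of [(a, t)], [(t, t^-1 * b)] and [(t, 1)] has [t] as a coordinate; the extra [t] cancels on
   both sides. *)
have -> : (a, b) = (a, t) * (t, t^-1 * b) * (t, 1)^-1 :> G * G.
  by congr pair; rewrite /= ?mulgK // mulKVg invg1 mulg1.
apply: (HM); last by apply/HV/inf_H/infinite_order_fst.
apply: HM; apply: inf_H; first exact: infinite_order_snd.
exact: infinite_order_fst.
Qed.

Theorem theorem6p4 :
  exists G : groupType,
    generated_by_infinite_order_elements G /\
    exists (k : nat) (x : 'I_k -> G),
      [/\ (0 < k)%N,
          forall i : 'I_k, torsion (x i)
        & forall g : G, \prod_(i < k) g ^ x i = 1].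
Proof.
exists (dihedral * dihedral)%type; split.
  exact: generated_by_infinite_order_square infinite_order_translation.
pose s : dihedral * dihedral := (reflection, reflection).
(* The conjugators are [1, 1, s, s], so the product is [(g * g) * (g * g) ^ s]. *)
exists 4, (fun i => if (i < 2)%N then 1 else s); split=> // [i|g].
  by exists 2; split=> //; case: ifP => _; rewrite expg2 // mulg1.
rewrite !big_ord_recl big_ord0 /= !conjg1 mulg1 -conjMg mulgA.
case: g => g h.
by congr pair; apply: sqr_mul_conj_reflection.
Qed.
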